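(* For every integer $n\geq 3$, $$a_n(1324,1423;213)=a_n(1324,1342;312)=\binom{n}{3}+1.$$
   Context: A permutation $\pi$ of $[n]=\{1,\dots,n\}$ is cyclic if it consists of a single $n$-cycle. Its one-line notation is $\pi_1\pi_2\cdots\pi_n$ with $\pi_i=\pi(i)$. Its standard cycle form is $(c_1,c_2,\dots,c_n)$ with $c_1=1$ and $c_{i+1}=\pi(c_i)$ for $1\le i<n$. A sequence $w_1\cdots w_n$ of distinct integers contains a pattern $\sigma=\sigma_1\cdots\sigma_k\in S_k$ if there are indices $i_1<\dots<i_k$ with $w_{i_s}>w_{i_t}$ iff $\sigma_s>\sigma_t$ for all $s<t$; otherwise it avoids $\sigma$. $\mathcal{A}_n(\sigma_1,\dots,\sigma_l;\rho)$ is the set of cyclic permutations of $[n]$ whose one-line notation avoids each $\sigma_i$ and whose standard cycle form $c_1\cdots c_n$, read as a sequence, avoids $\rho$; $a_n(\sigma_1,\dots,\sigma_l;\rho)$ is its cardinality. *)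

(* Defs.v *)
From mathcomp Require Import all_boot fingroup perm.

Set Implicit Arguments.
Unset Strict Implicit.
Unset Printing Implicit Defensive.

(* A permutation of [n] = {1, ..., n} is an element of 'S_n acting on
   'I_n = {0, ..., n-1}; the integer i.+1 of [n] is represented by i : 'I_n.
   The words below are written with the letters 1, ..., n. *)

Definition is_cyclic_perm (n : nat) (p : 'S_n) : bool :=
  porbits p == [set [set: 'I_n]].

Definition one_line (n : nat) (p : 'S_n) : seq nat :=
  [seq (p i : nat).+1 | i <- enum 'I_n].

(* [insub 0] is the element 0 : 'I_n (the letter 1), which exists iff n > 0. *)
Definition cycle_form (n : nat) (p : 'S_n) : seq nat :=
  if insub 0 is Some c1 then [seq (i : nat).+1 | i : 'I_n <- traject p c1 n]
  else [::].

Definition contains (w sigma : seq nat) : bool :=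
  [exists f : {ffun 'I_(size sigma) -> 'I_(size w)},
    [forall s : 'I_(size sigma), forall t : 'I_(size sigma),
      (s < t) ==>
      (f s < f t) &&
      ((nth 0 w (f s) > nth 0 w (f t)) == (nth 0 sigma s > nth 0 sigma t))]].

Definition avoids (w sigma : seq nat) : bool := ~~ contains w sigma.

Definition A_set (n : nat) (sigmas : seq (seq nat)) (rho : seq nat)
    : {set 'S_n} :=
  [set p : 'S_n | [&& is_cyclic_perm p,
                      all (avoids (one_line p)) sigmas &
                      avoids (cycle_form p) rho]].

Definition a_num (n : nat) (sigmas : seq (seq nat)) (rho : seq nat) : nat :=
  #|A_set n sigmas rho|.

(* Main.v *)
Require Import Defs.
From mathcomp Require Import all_boot fingroup perm zify.

Set Implicit Arguments.
Unset Strict Implicit.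
Unset Printing Implicit Defensive.

(* Inversion fixes 1324, exchanges 1423 with 1342, and reverses the cycle form
   after its initial 1, which exchanges 213 with 312; so the two numbers agree.

   For the first one, let c = (1, c_2, ..., c_n) be the cycle form. If c starts
   with 1, n, 2, then deleting n and 2 is a bijection onto the same set for
   n - 2. Otherwise c_2 and 213-avoidance split the rest of c into the letters
   above c_2 followed by those below, and the one-line patterns leave exactly
   four explicit families of words, which have (n - 2)^2 members altogether.
   Hence a_n = a_{n-2} + (n - 2)^2 with a_1 = a_2 = 1, which is solved by
   binom(n, 3) + 1. *)

(** The lever is the last letter of the cycle form, the preimage of 1. It can play the 1 of both
    one-line patterns for all positions to its right, so among the images of those positions none is
    smaller than both an image to its left and one to its right: they increase, then decrease. If
    the cycle form starts with 1, 2, then position 1, with image 2, does the same for the positions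
    whose images exceed 2. The families are what these constraints leave.

    The prefix 1, n, 2 escapes them. Position 1 is leftmost and has the largest image; position n is
    rightmost and has image 2, too small for the last letter of either pattern. Neither takes part
    in an occurrence, so the rest of the word is an arbitrary smaller solution; hence a recursion
    with step two instead of one more family. *)

(* The cycle form as a function of the index, closed up by c n = 1, so that the
   permutation maps c i to c i.+1 for all i < n. In [cf_4] the letters 3 and 4
   of 1324 and 1423 are not compared: avoiding both patterns means that no
   positions x < y < z < t have p z above p x and below both p y and p t. *)
Record cycle_fun (n : nat) (c : nat -> nat) : Prop := CycleFun {
  cf_0 : c 0 = 1;
  cf_n : c n = 1;
  cf_rng : forall i, i < n -> 1 <= c i <= n;
  cf_inj : forall i j, i < n -> j < n -> c i = c j -> i = j;
  cf_213 : forall i j k, i < j -> j < k -> k < n -> c j < c i -> c i < c k -> False;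
  cf_4 : forall i1 i2 i3 i4, i1 < n -> i2 < n -> i3 < n -> i4 < n ->
    c i1 < c i2 -> c i2 < c i3 -> c i3 < c i4 ->
    c i1.+1 < c i3.+1 -> c i3.+1 < c i2.+1 -> c i3.+1 < c i4.+1 -> False }.

(* The words (1, ..., k, k+2, ..., n, k+1). *)
Definition fam1 n k i := if i < k then i.+1 else if i < n.-1 then i.+2 else k.+1.

(* The words (1, ..., k, n, k+1, n-1, k+2, ...). *)
Definition fam2 n k i :=
  if i < k then i.+1 else
  if odd (i - k) then (k + (i - k)./2).+1 else n - (i - k)./2.

(* The words (1, j, ..., n, j-1, ..., r, 2, ..., r-1). *)
Definition fam3 n j r i :=
  if i == 0 then 1 else if i <= (n - j).+1 then (j + i).-1 else
  if i <= (n - r).+1 then n.+1 - i else i - (n - r).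

(* The words (1, j, ..., n, 2, j-1, ..., r, 3, ..., r-1). *)
Definition fam4 n j r i :=
  if i == 0 then 1 else if i <= (n - j).+1 then (j + i).-1 else
  if i == (n - j).+2 then 2 else
  if i <= (n - r).+2 then n.+2 - i else i - (n - r).

Ltac iflia := repeat case: ifP => ?; lia.

(** * Structure of the blocks forced by 213 and the one-line patterns *)

Section CycleFun.

Variables (n : nat) (c : nat -> nat).
Hypothesis cf : cycle_fun n c.

Lemma cf_sur x : 1 <= x <= n -> exists2 i, i < n & c i = x.
Proof.
move=> hx.
have u : uniq (mkseq c n).
  apply/(uniqP 0) => i j; rewrite !inE size_mkseq => hi hj.
  by rewrite !nth_mkseq //; apply: (cf_inj cf).
have s : {subset mkseq c n <= iota 1 n}.
  move=> y /mapP [i]; rewrite mem_iota => hi ->; rewrite mem_iota.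
  by have := cf_rng cf (i:=i); lia.
have [|_ e] := uniq_min_size u s; first by rewrite size_iota size_mkseq.
have : x \in mkseq c n by rewrite e mem_iota; lia.
by case/mapP => i; rewrite mem_iota => hi ->; exists i; lia.
Qed.

Lemma cf_gt1 i : 0 < i -> i < n -> 1 < c i.
Proof.
move=> i0 hi; have := cf_rng cf hi.
have := cf_inj cf hi (j := 0); rewrite (cf_0 cf).
by case: (c i) => [|[|m]] // h; have := h _ erefl; lia.
Qed.

Lemma crossing (P : pred nat) a b :
  a < b -> P a -> ~~ P b -> exists t, [/\ a <= t, t < b, P t & ~~ P t.+1].
Proof.
move=> + Pa; elim: b => // b IH ab Pb.
case: (boolP (P b)) => Pb'; first by exists b; split => //; lia.
have ab' : a < b by rewrite ltn_neqAle -ltnS ab andbT; apply: contraNneq Pb' => <-.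
by have [t [h1 h2 h3 h4]] := IH ab' Pb'; exists t; split => //; lia.
Qed.

(* In a 213-avoiding word, what follows the letter m = c i consists of all
   letters above m, then all letters below m; t is the last index of the
   first block. The forbidden pair of one-line patterns, applied with the
   smallest value 1 = c n in the role of the letter 1, bounds the images of
   the letters above c t. *)
Lemma block_crossing i s g : i < s -> s < n -> c s < c i ->
  i < g -> g < n -> c i < c g ->
  exists t, [/\ i < t, t.+1 < n,
    forall u, i < u -> u <= t -> c i < c u,
    forall u, t < u -> u < n -> c u < c i &
    forall d, d < n -> c t < c d -> c d.+1 < c t.+1].
Proof.
move=> is_ sn cs ig gn cg.
(* A larger letter after a smaller one would complete a 213 in which [c i] is the 2. *)
have lo u v : i < u -> u < v -> v < n -> c u < c i -> c v < c i.
  move=> iu uv vn cu; case: (ltngtP (c v) (c i)) => // h.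
    by case: (cf_213 cf iu uv vn).
  by have := cf_inj cf vn _ h; lia.
have gs : g < s.
  case: (ltngtP g s) => // h; first by have := lo s g; lia.
  by subst; lia.
have cs1 : c i.+1 > c i.
  case: (ltngtP (c i.+1) (c i)) => // h; last by have := cf_inj cf _ _ h; lia.
  case: (ltngtP i.+1 g) => h'; [|lia|by subst; lia].
  by have := lo i.+1 g; lia.
have iss : i.+1 < s.
  by case: (ltngtP i.+1 s) => // h'; [lia|subst; lia].
have [|t [h1 h2 h3]] := @crossing (fun u => c i < c u) i.+1 s iss cs1.
  by rewrite -leqNgt ltnW.
have nt : t.+1 < n by lia.
rewrite -leqNgt => h4.
have h5 : c t.+1 < c i.
  by case: (ltngtP (c t.+1) (c i)) h4 => // h _; have := cf_inj cf _ _ h; lia.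
exists t; split => //.
- move=> u iu ut; case: (ltngtP (c i) (c u)) => // h.
    case: (ltngtP u t) => h'; [|lia|by subst; lia].
    by have := lo u t; lia.
  by have := cf_inj cf _ _ h; lia.
- move=> u tu un; case: (ltngtP t.+1 u) => h'; [|lia|by subst].
  by have := lo t.+1 u; lia.
- move=> d dn ctd; case: (ltngtP (c d.+1) (c t.+1)) => // h.
    have cl : c n.-1 < c i.
      case: (ltngtP t.+1 n.-1) => h'; [|lia|by rewrite -h'].
      by have := lo t.+1 n.-1; lia.
    have [] := @cf_4 n c cf n.-1 i t d; try lia.
    + have -> : n.-1.+1 = n by lia.
      by rewrite (cf_n cf); apply: cf_gt1; lia.
  have dn' : d.+1 < n.
    case: (ltngtP d.+1 n) => h'; [by []|lia|].
    by move: h; rewrite h' (cf_n cf); have := @cf_gt1 t.+1; lia.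
  have dt : d = t by have := cf_inj cf _ _ h; lia.
  by subst; lia.
Qed.

(** A descent before index [b] would form a 213 with the maximal letter [c b], so the stretch
    increases; as it contains every letter between its ends, all its steps are 1. *)
Lemma stretch_increasing a b : a <= b -> b < n ->
  (forall i, a <= i -> i <= b -> c i <= c b) ->
  (forall x, c a <= x -> x <= c b -> exists i, [/\ a <= i, i <= b & c i = x]) ->
  forall i, a <= i -> i <= b -> c i = c a + (i - a).
Proof.
move=> ab bn hmax hsur.
have inc i j : a <= i -> i < j -> j <= b -> c i < c j.
  move=> ai ij jb; case: (ltngtP (c i) (c j)) => // h; last first.
    by have := cf_inj cf _ _ h; lia.
  have hi := hmax i ai ltac:(lia).
  have e : c i <> c b by move=> e; have := cf_inj cf _ _ e; lia.
  case: (ltngtP j b) => h'; [|lia|by subst; lia].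
  by have := cf_213 cf ij h'; lia.
elim => [|i IH] ai ib; first by rewrite (_ : a = 0) ?addn0 //; lia.
case: (ltngtP a i.+1) => h; [|lia|by rewrite h subnn addn0].
have e := IH ltac:(lia) ltac:(lia).
have h1 := inc i i.+1 ltac:(lia) ltac:(lia) ib.
have h2 := hmax i.+1 ltac:(lia) ib.
case: (ltngtP (c i).+1 (c i.+1)) => h3; [|lia|lia].
have [j [j1 j2 j3]] := hsur (c i).+1 ltac:(lia) ltac:(lia).
case: (ltngtP i.+1 j) => h4.
- by have := inc _ _ _ h4; lia.
- case: (ltngtP j i) => h5; [|lia|subst; lia].
  by have := inc _ _ _ h5; lia.
- by subst; lia.
Qed.

(** The tail consists of the letters from [s] to just below [c i0]; the large position [c d] with
    its large image plays the last letter of a pattern. The next letter can only be the largest one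
    left, which repeats the situation with one letter less, or the smallest, after which the rest
    must increase. Requiring [s < q] gives the fully decreasing tail only one description. *)
Lemma descent_then_ascent i0 s d : i0 < n -> s < c i0 -> n.-1 - i0 = c i0 - s ->
  (forall i, i0 < i -> i < n -> s <= c i < c i0) ->
  (forall x, s <= x -> x < c i0 -> exists i, [/\ i0 < i, i < n & c i = x]) ->
  d < n -> c i0 < c d -> c i0 <= c d.+1 ->
  exists q, [/\ s < q, q <= c i0 & forall i, i0 < i -> i < n ->
    c i = if i <= i0 + (c i0 - q) then c i0 - (i - i0)
          else s + (i - (i0 + (c i0 - q)) - 1)].
Proof.
move: {2}(c i0 - s) (leqnn (c i0 - s)) => m.
elim: m i0 => [|m IH] i0 hm in0 sc e rng sur dn cd cd1; first by lia.
have i1n : i0.+1 < n by lia.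
have r1 := rng i0.+1 (leqnn _) i1n.
case: (ltngtP (c i0.+1) s) => hs; first by lia.
- case: (ltngtP (c i0.+1).+1 (c i0)) => hr; [|lia|].
  + have [a [a1 a2 a3]] := sur s ltac:(lia) ltac:(lia).
    have [b [b1 b2 b3]] := sur (c i0.+1).+1 ltac:(lia) ltac:(lia).
    have a1' : i0.+1 < a by case: (ltngtP i0.+1 a) => h; [|lia|subst; lia].
    have b1' : i0.+1 < b by case: (ltngtP i0.+1 b) => h; [|lia|subst; lia].
    (* A next letter strictly between the extremes would force [c d.+1] below [c t.+1], hence below
       [c i0]. *)
    have [t [t1 t2 t3 t4 t5]] := @block_crossing i0.+1 a b a1' a2 ltac:(lia) b1' b2 ltac:(lia).
    have := rng t ltac:(lia) ltac:(lia).
    have := rng t.+1 ltac:(lia) ltac:(lia).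
    by have := t5 d dn; lia.
  + have rng' i : i0.+1 < i -> i < n -> s <= c i < c i0.+1.
      move=> h1 h2; have := rng i ltac:(lia) h2.
      suff : c i <> c i0.+1 by lia.
      by move=> h; have := cf_inj cf _ _ h; lia.
    have sur' x : s <= x -> x < c i0.+1 -> exists i, [/\ i0.+1 < i, i < n & c i = x].
      move=> x1 x2; have [i [h1 h2 h3]] := sur x ltac:(lia) ltac:(lia).
      exists i; split => //.
      by case: (ltngtP i0.+1 i) => h; [|lia|subst; lia].
    have [q [q1 q2 q3]] := IH i0.+1 ltac:(lia) i1n hs ltac:(lia) rng' sur' dn
      ltac:(lia) ltac:(lia).
    exists q; split; [lia|lia|] => i h1 h2.
    case: (ltngtP i0.+1 i) => h; [|lia|].
      rewrite q3 // -hr.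
      have -> : i0.+1 + (c i0.+1 - q) = i0 + ((c i0.+1).+1 - q) by lia.
      by case: ifP => //; lia.
    by subst i; case: ifP => //; lia.
- have cl : c n.-1 = (c i0).-1.
    have rl := rng n.-1 ltac:(lia) ltac:(lia).
    apply/eqP; apply: contraT => h.
    have [b [b1 b2 b3]] := sur (c i0).-1 ltac:(lia) ltac:(lia).
    have bn : b < n.-1.
      case: (ltngtP b n.-1) => h'; [by []|lia|subst; lia].
    have b1' : i0.+1 <= b by lia.
    have hb := rng b.+1 ltac:(lia) ltac:(lia).
    have hb' : c b.+1 <> s.
      by rewrite -hs => h'; have := cf_inj cf _ _ h'; lia.
    (* The positions [c n.-1 < c b < c i0 < c d], with images 1, [c b.+1], [s] and [c d.+1], form
       one of the two patterns. *)
    have [] := @cf_4 n c cf n.-1 b i0 d; try lia.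
    have -> : n.-1.+1 = n by lia.
    by rewrite (cf_n cf); apply: cf_gt1; lia.
  exists (c i0); split; [lia|lia|] => i h1 h2.
  have := @stretch_increasing i0.+1 n.-1 ltac:(lia) ltac:(lia) _ _ i h1 ltac:(lia).
  rewrite hs => ->; first by case: ifP; lia.
    by move=> u u1 u2; have := rng u u1 ltac:(lia); lia.
  move=> x x1 x2; have [u [u1 u2 u3]] := sur x x1 ltac:(lia).
  by exists u; split; lia.
Qed.

End CycleFun.

(** * Classification of the words by their second letter *)

Section Classification.

Variables (n : nat) (c : nat -> nat).
Hypothesis cf : cycle_fun n c.

Lemma cf_neq i j : i < n -> j < n -> i <> j -> c i <> c j.
Proof. by move=> hi hj ij e; apply: ij; apply: (cf_inj cf). Qed.

(** Position [n] has image [c 2]. If both smaller and larger letters followed [c 2], the bound of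
    [block_crossing] would put this image below a letter that is itself below [c 2]; so [c 2] is
    [n.-1]. The value [r = n] is missing because it would give [c 2 = 2]. *)
Lemma second_max : 3 <= n -> c 1 = n -> c 2 <> 2 ->
  exists2 r, 3 <= r < n & forall i, i < n -> c i = fam3 n n r i.
Proof.
move=> n3 c1 c2; have c0 := cf_0 cf.
have h2 := cf_gt1 cf (i := 2) isT n3.
have r2 := cf_rng cf n3.
have n2 := @cf_neq 1 2 ltac:(lia) ltac:(lia) ltac:(lia).
have after x : 2 <= x -> x < n -> x <> c 2 -> exists i, [/\ 2 < i, i < n & c i = x].
  move=> x1 x2 x3; have [i hi e] := @cf_sur n c cf x ltac:(lia).
  by exists i; split => //; move: hi e; case: i => [|[|[|i]]] //; lia.
have e2 : c 2 = n.-1.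
  apply/eqP; apply: contraT => h.
  have [a [a1 a2 a3]] := after 2 ltac:(lia) ltac:(lia) ltac:(lia).
  have [b [b1 b2 b3]] := after n.-1 ltac:(lia) ltac:(lia) ltac:(lia).
  have [t [t1 t2 t3 t4 t5]] :=
    block_crossing cf a1 a2 ltac:(lia) b1 b2 ltac:(lia).
  have := t5 1 ltac:(lia); have := t4 t.+1 ltac:(lia) ltac:(lia).
  have := @cf_neq 1 t ltac:(lia) ltac:(lia) ltac:(lia).
  by have := cf_rng cf (i:=t); lia.
have rng i : 2 < i -> i < n -> 2 <= c i < c 2.
  move=> i2 hi; have := @cf_gt1 n c cf i ltac:(lia) hi; have := cf_rng cf hi.
  have := @cf_neq 1 i ltac:(lia) ltac:(lia) ltac:(lia).
  by have := @cf_neq 2 i ltac:(lia) ltac:(lia) ltac:(lia); lia.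
have sur x : 2 <= x -> x < c 2 -> exists i, [/\ 2 < i, i < n & c i = x].
  by move=> x1 x2; apply: after; lia.
have [q [q1 q2 q3]] := @descent_then_ascent n c cf 2 2 1 n3 ltac:(lia)
  ltac:(lia) rng sur ltac:(lia) ltac:(lia) ltac:(lia).
exists q; first by lia.
move=> i hi; rewrite /fam3; case: i hi => [|[|[|i]]] hi //=.
- by iflia.
- by iflia.
- by rewrite q3 //; iflia.
Qed.

(** The letters from [j] to [n] come first and increase, so position [j] has image [j.+1]. The first
    low letter is then [j.-1] or 2. After 2, the next one is [j.-1], which gives [fam4], or 3, after
    which everything increases: this is [fam3] with [r = j]. *)
Lemma second_middle : 3 <= c 1 < n ->
  (exists2 r, 3 <= r <= c 1 & forall i, i < n -> c i = fam3 n (c 1) r i) \/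
  (exists2 r, 4 <= r < c 1 & forall i, i < n -> c i = fam4 n (c 1) r i).
Proof.
move ej : (c 1) => j hj; have c0 := cf_0 cf.
have [a a2 a3] := @cf_sur n c cf 2 ltac:(lia).
have [d d2 d3] := @cf_sur n c cf n ltac:(lia).
have a1 : 1 < a by move: a3; case: (a) => [|[|u]] //; lia.
have d1 : 1 < d by move: d3; case: (d) => [|[|u]] //; lia.
have [t [t1 t2 t3 t4 t5]] := block_crossing cf a1 a2 ltac:(lia) d1 d2 ltac:(lia).
rewrite ej in t3 t4.
have dt : d <= t by case: (leqP d t) => // h; have := t4 d h d2; lia.
have ct : c t = n.
  apply/eqP; apply: contraT => h.
  have := cf_rng cf (i := t) ltac:(lia) => rt.
  have := t5 d d2 ltac:(lia).
  have := t4 t.+1 ltac:(lia) ltac:(lia).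
  have : d <> t by move=> e; subst; lia.
  by have := t3 d.+1 ltac:(lia); lia.
have asc : forall i, 1 <= i -> i <= t -> c i = j + (i - 1).
  rewrite -ej; apply: (stretch_increasing cf); [lia|lia| |].
    by move=> i i1 i2; have := cf_rng cf (i := i); lia.
  move=> x x1 x2; have [i i1 i2] := @cf_sur n c cf x ltac:(lia).
  exists i; split => //; first by move: i2; case: (i) => //; lia.
  by case: (leqP i t) => // h; have := t4 i h i1; lia.
have et : t = (n - j).+1 by have := asc t; lia.
have low u : t < u -> u < n -> 2 <= c u < j.
  by move=> u1 u2; have := t4 u u1 u2; have := cf_gt1 cf (i := u); lia.
have lowsur x : 2 <= x -> x < j -> exists i, [/\ t < i, i < n & c i = x].
  move=> x1 x2; have [i i1 i2] := @cf_sur n c cf x ltac:(lia).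
  exists i; split => //; case: (ltnP t i) => // h.
  case: (posnP i) => i0; first by subst; lia.
  by have := asc i; lia.
(* Index 1 carries [j], whose image [j.+1] violates the bound of [block_crossing]; so no low letter
   is followed by both smaller and larger ones. *)
have nomid i u v : t < i -> i < u -> u < n -> i < v -> v < n ->
    c u < c i -> c i < c v -> False.
  move=> ti iu un iv vn cu cv.
  have [t' [s1 s2 s3 s4 s5]] := block_crossing cf iu un cu iv vn cv.
  have := s5 1 ltac:(lia); have := s4 t'.+1 ltac:(lia) ltac:(lia).
  have := low t' ltac:(lia) ltac:(lia).
  have := low i ltac:(lia) ltac:(lia).
  by have := asc 2; lia.
have l1 := low t.+1 ltac:(lia) ltac:(lia).
have c2 := asc 2 ltac:(lia) ltac:(lia).
case: (ltngtP (c t.+1) 2) => hf; first by lia.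
  have hf' : c t.+1 = j.-1.
    apply/eqP; apply: contraT => h.
    have [u [u1 u2 u3]] := lowsur 2 ltac:(lia) ltac:(lia).
    have [v [v1 v2 v3]] := lowsur j.-1 ltac:(lia) ltac:(lia).
    have u1' : t.+1 < u by case: (ltngtP t.+1 u) => h'; [|lia|subst; lia].
    have v1' : t.+1 < v by case: (ltngtP t.+1 v) => h'; [|lia|subst; lia].
    by case: (nomid t.+1 u v); lia.
  left.
  have rng i : t.+1 < i -> i < n -> 2 <= c i < c t.+1.
    move=> i1 i2; have := low i ltac:(lia) i2.
    by have := @cf_neq t.+1 i ltac:(lia) ltac:(lia) ltac:(lia); lia.
  have sur x : 2 <= x -> x < c t.+1 -> exists i, [/\ t.+1 < i, i < n & c i = x].
    move=> x1 x2; have [i [i1 i2 i3]] := lowsur x ltac:(lia) ltac:(lia).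
    exists i; split => //.
    by case: (ltngtP t.+1 i) => h'; [|lia|subst; lia].
  have [q [q1 q2 q3]] := @descent_then_ascent n c cf t.+1 2 1 t2 ltac:(lia)
    ltac:(lia) rng sur ltac:(lia) ltac:(lia) ltac:(lia).
  exists q; first by lia.
  move=> i hi; rewrite /fam3; case: eqP => [->//|i0].
  case: leqP => i1; first by rewrite asc; lia.
  case: (ltngtP t.+1 i) => h; [|lia|subst i].
    by rewrite q3 //; iflia.
  by iflia.
have [j4|j4] := leqP j 3.
  left; exists 3; first by lia.
  move=> i hi; rewrite /fam3; case: eqP => [->//|i0].
  case: leqP => i1; first by rewrite asc; lia.
  have -> : i = t.+1 by lia.
  by iflia.
have t3n : t.+2 < n by lia.
have l2 := low t.+2 ltac:(lia) ltac:(lia).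
have ne12 := @cf_neq t.+1 t.+2 ltac:(lia) ltac:(lia) ltac:(lia).
case: (ltngtP (c t.+2) 3) => hg; first by lia.
  have hg' : c t.+2 = j.-1.
    apply/eqP; apply: contraT => h.
    have [u [u1 u2 u3]] := lowsur 3 ltac:(lia) ltac:(lia).
    have [v [v1 v2 v3]] := lowsur j.-1 ltac:(lia) ltac:(lia).
    have u0 : t.+1 <> u by move=> e; subst; lia.
    have v0 : t.+1 <> v by move=> e; subst; lia.
    have u0' : t.+2 <> u by move=> e; subst; lia.
    have v0' : t.+2 <> v by move=> e; subst; lia.
    by case: (nomid t.+2 u v); lia.
  right.
  have rng i : t.+2 < i -> i < n -> 3 <= c i < c t.+2.
    move=> i1 i2; have := low i ltac:(lia) i2.
    have := @cf_neq t.+1 i ltac:(lia) ltac:(lia) ltac:(lia).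
    by have := @cf_neq t.+2 i ltac:(lia) ltac:(lia) ltac:(lia); lia.
  have sur x : 3 <= x -> x < c t.+2 -> exists i, [/\ t.+2 < i, i < n & c i = x].
    move=> x1 x2; have [i [i1 i2 i3]] := lowsur x ltac:(lia) ltac:(lia).
    exists i; split => //.
    have u0 : t.+1 <> i by move=> e; subst; lia.
    have u0' : t.+2 <> i by move=> e; subst; lia.
    by lia.
  have [q [q1 q2 q3]] := @descent_then_ascent n c cf t.+2 3 1 t3n ltac:(lia)
    ltac:(lia) rng sur ltac:(lia) ltac:(lia) ltac:(lia).
  exists q; first by lia.
  move=> i hi; rewrite /fam4; case: eqP => [->//|i0].
  case: leqP => i1; first by rewrite asc; lia.
  case: eqP => [i2|i2]; first by rewrite (_ : i = t.+1); lia.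
  case: (ltngtP t.+2 i) => h; [|lia|subst i].
    by rewrite q3 //; iflia.
  by iflia.
(* Here 2 |-> 3, so a later descent in the images would create 1324 or 1423. *)
left.
have asc2 m u : u < m -> t.+1 <= u -> u < n -> c u = u - t.+1 + 2.
  elim: m u => // m IH u um tu un.
  case: (ltngtP u t.+2) => hu; [by rewrite (_ : u = t.+1); lia| |by subst u; lia].
  have lu := low u ltac:(lia) un.
  have cu1 := IH u.-1 ltac:(lia) ltac:(lia) ltac:(lia).
  have ge v : u <= v -> v < n -> u - t.+1 + 2 <= c v.
    move=> uv vn; rewrite leqNgt; apply/negP => h.
    have lv := low v ltac:(lia) vn.
    have := IH (c v + t.+1 - 2) ltac:(lia) ltac:(lia) ltac:(lia).
    by have := @cf_neq v (c v + t.+1 - 2) ltac:(lia) ltac:(lia) ltac:(lia); lia.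
  apply/eqP; apply: contraT => h.
  have hgu := ge u (leqnn _) un.
  have [v [v1 v2 v3]] := lowsur (u - t.+1 + 2) ltac:(lia) ltac:(lia).
  have uv : u < v.
    case: (ltngtP u v) => // h'; last by subst v; lia.
    by have := IH v ltac:(lia) ltac:(lia) ltac:(lia); lia.
  have gv := ge v.-1 ltac:(lia) ltac:(lia).
  have lv := low v.-1 ltac:(lia) ltac:(lia).
  have ev : v.-1.+1 = v by lia.
  have eu : u.-1.+1 = u by lia.
  by have := @cf_4 n c cf t.+1 u.-1 v.-1 1; rewrite ev eu; lia.
exists j; first by lia.
move=> i hi; rewrite /fam3; case: eqP => [->//|i0].
case: leqP => i1; first by rewrite asc; lia.
by rewrite (asc2 i.+1); lia.
Qed.

(** Position 1 with image 2 and position [k] with image [n] play the first two letters of a pattern.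
    From index [k + 2 * q] on, the letters left are those from [(k + q).+1] to [n - q]; each step
    must take the largest, then the smallest, since otherwise the predecessor of the postponed
    letter completes a pattern. *)
Lemma zigzag k : 2 <= k -> k.+2 <= n -> (forall i, i < k -> c i = i.+1) ->
  c k = n -> forall i, i < n -> c i = fam2 n k i.
Proof.
move=> k2 kn pre ck; have c0 := cf_0 cf.
have [c1 ck1] : c 1 = 2 /\ c k.-1 = k by rewrite !pre; lia.
have kk : k.-1.+1 = k by lia.
have even_step q : (forall q', q' < q ->
      (k + 2 * q' < n -> c (k + 2 * q') = n - q') /\
      ((k + 2 * q').+1 < n -> c (k + 2 * q').+1 = (k + q').+1)) ->
    (forall i, k + 2 * q <= i -> i < n -> k + q < c i <= n - q) /\
    (k + 2 * q < n -> c (k + 2 * q) = n - q).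
  move=> IH.
  have R i : k + 2 * q <= i -> i < n -> k + q < c i <= n - q.
    move=> qi hi; have ri := cf_rng cf hi.
    apply/andP; split; rewrite leqNgt; apply/negP => h.
      case: (leqP (c i) k) => h'.
        have := pre (c i).-1 ltac:(lia).
        by have := @cf_neq i (c i).-1 ltac:(lia) ltac:(lia) ltac:(lia); lia.
      have [_] := IH (c i - k.+1) ltac:(lia).
      have := @cf_neq i (k + 2 * (c i - k.+1)).+1 ltac:(lia) ltac:(lia) ltac:(lia).
      by lia.
    have [+ _] := IH (n - c i) ltac:(lia).
    by have := @cf_neq i (k + 2 * (n - c i)) ltac:(lia) ltac:(lia) ltac:(lia); lia.
  split=> // kq; case: (posnP q) => q0; first by subst q; rewrite muln0 addn0 ck subn0.
  have [_ x0] := IH q.-1 ltac:(lia).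
  have e0 : (k + 2 * q.-1).+2 = k + 2 * q by lia.
  have {}x0 := x0 ltac:(lia).
  have Ry := R (k + 2 * q) (leqnn _) kq.
  apply/eqP; apply: contraT => ny.
  have [v vn ev] := @cf_sur n c cf (n - q) ltac:(lia).
  have kv : k + 2 * q < v.
    case: (ltngtP v (k + 2 * q)) => // h; last by subst v; lia.
    case: (ltnP v k) => vk; first by have := pre v vk; lia.
    have [h1 h2] := IH ((v - k) %/ 2) ltac:(lia).
    have : v = k + 2 * ((v - k) %/ 2) \/ v = (k + 2 * ((v - k) %/ 2)).+1 by lia.
    by case=> e; rewrite -e in h1 h2; lia.
  have Rv := R v.-1 ltac:(lia) ltac:(lia).
  have vv : v.-1.+1 = v by lia.
  (* Here [k + q] has an image below [n - q], while the larger position [c v.-1] has image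
     [n - q]. *)
  have := @cf_4 n c cf 0 k.-1 (k + 2 * q.-1).+1 v.-1.
  by rewrite e0 vv kk; lia.
have odd_step q : (forall q', q' < q ->
      (k + 2 * q' < n -> c (k + 2 * q') = n - q') /\
      ((k + 2 * q').+1 < n -> c (k + 2 * q').+1 = (k + q').+1)) ->
    (forall i, k + 2 * q <= i -> i < n -> k + q < c i <= n - q) ->
    c (k + 2 * q) = n - q -> (k + 2 * q).+1 < n ->
    c (k + 2 * q).+1 = (k + q).+1.
  move=> IH R x0 kq.
  have Ry := R (k + 2 * q).+1 ltac:(lia) kq.
  apply/eqP; apply: contraT => ny.
  have [v vn ev] := @cf_sur n c cf (k + q).+1 ltac:(lia).
  have kv : (k + 2 * q).+1 < v.
    case: (leqP v (k + 2 * q).+1) => // h.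
    case: (ltngtP v (k + 2 * q).+1) h => // h _; last by subst v; lia.
    case: (ltnP v k) => vk; first by have := pre v vk; lia.
    case: (ltngtP v (k + 2 * q)) => hv; [|lia|by subst v; lia].
    have [h1 h2] := IH ((v - k) %/ 2) ltac:(lia).
    have : v = k + 2 * ((v - k) %/ 2) \/ v = (k + 2 * ((v - k) %/ 2)).+1 by lia.
    by case=> e; rewrite -e in h1 h2; lia.
  have Rv := R v.-1 ltac:(lia) ltac:(lia).
  have nv := @cf_neq v.-1 (k + 2 * q) ltac:(lia) ltac:(lia) ltac:(lia).
  have vv : v.-1.+1 = v by lia.
  (* Here [c v.-1] has image [(k + q).+1], while the larger position [n - q] has a larger image. *)
  have := @cf_4 n c cf 0 k.-1 v.-1 (k + 2 * q).
  by rewrite vv kk; lia.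
have all q : forall q', q' < q ->
      (k + 2 * q' < n -> c (k + 2 * q') = n - q') /\
      ((k + 2 * q').+1 < n -> c (k + 2 * q').+1 = (k + q').+1).
  elim: q => // q IH q'; rewrite ltnS leq_eqVlt => /orP [/eqP ->|]; last exact: IH.
  have [R E] := even_step q IH; split=> // h.
  by apply: (odd_step q IH) => //; apply: E; lia.
move=> i hi; rewrite /fam2; case: ltnP => ik; first exact: pre.
have [h1 h2] := all (i - k)./2.+1 (i - k)./2 (leqnn _).
have := odd_double_half (i - k).
case: ifP => hh e.
  have ei : i = (k + 2 * (i - k)./2).+1 by lia.
  by rewrite [in LHS]ei h2 //; lia.
have ei : i = k + 2 * (i - k)./2 by lia.
by rewrite [in LHS]ei h1 //; lia.
Qed.

(** Everything depends on the first index [k] at which the word leaves 1, 2, 3, ...: the letter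
    there is [n], which starts the zigzag, or [k.+2], and then only [k.+1] remains below it and
    comes last. *)
Lemma second_two : 3 <= n -> c 1 = 2 ->
  (exists2 k, 2 <= k < n & forall i, i < n -> c i = fam1 n k i) \/
  (exists2 k, 2 <= k & k.+3 <= n /\ forall i, i < n -> c i = fam2 n k i).
Proof.
move=> n3 c1; have c0 := cf_0 cf.
have pre m : (forall i, i < m -> c i = i.+1) \/
    exists k, [/\ k < m, c k <> k.+1 & forall i, i < k -> c i = i.+1].
  elim: m => [|m [IH|[k [k1 k2 k3]]]]; first by left.
    case: (c m =P m.+1) => h; [left|right; exists m; split=> //].
    by move=> i; rewrite ltnS leq_eqVlt => /orP [/eqP ->|/IH].
  by right; exists k; split => //; lia.
case: (pre n) => [all|[k [kn ck {}pre]]].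
  left; exists n.-1; first by lia.
  by move=> i hi; rewrite all // /fam1; iflia.
have k2 : 2 <= k by move: ck; case: (k) => [|[|u]] //; lia.
have gt i : k <= i -> i < n -> k < c i.
  move=> ki hi; rewrite ltnNge; apply/negP => h; have := cf_rng cf hi.
  have := pre (c i).-1; have := @cf_neq i (c i).-1; lia.
have sur x : k < x -> x <= n -> exists i, [/\ k <= i, i < n & c i = x].
  move=> x1 x2; have [i i1 i2] := @cf_sur n c cf x ltac:(lia).
  exists i; split=> //; case: (leqP k i) => // h; have := pre i h; lia.
have gk := gt k (leqnn _) kn.
have rk := cf_rng cf kn.
have c0' : c k.-1 = k by rewrite pre; lia.
have kk : k.-1.+1 = k by lia.
case: (ltngtP (c k) n) => ckn; [|lia|]; last first.
  (* For [n = k.+2] the zigzag is also a word of [fam1], and is counted there. *)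
  case: (ltnP n k.+3) => nk.
    left; exists k; first by lia.
    move=> i hi; rewrite /fam1; case: ltnP => ik; first exact: pre.
    case: ltnP => ik'; first by rewrite (_ : i = k); lia.
    have ei : i = k.+1 by lia.
    have := gt i ik hi; have := @cf_neq i k; have := cf_rng cf hi; lia.
  right; exists k => //; split=> //; apply: zigzag => //; lia.
left; exists k; first by lia.
have [a [a1 a2 a3]] := sur k.+1 ltac:(lia) ltac:(lia).
have [d [d1 d2 d3]] := sur n ltac:(lia) ltac:(lia).
have ka : k < a by case: (ltngtP k a) => h; [|lia|subst; lia].
have kd : k < d by case: (ltngtP k d) => h; [|lia|subst; lia].
have [t [t1 t2 t3 t4 t5]] := block_crossing cf ka a2 ltac:(lia) kd d2 ltac:(lia).
have dt : d <= t by case: (leqP d t) => // h; have := t4 d h d2; lia.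
have ct : c t = n.
  apply/eqP; apply: contraT => h.
  have := cf_rng cf (i := t) ltac:(lia) => rt.
  have := t5 d d2 ltac:(lia).
  have := t4 t.+1 ltac:(lia) ltac:(lia).
  have : d <> t by move=> e; subst; lia.
  by have := t3 d.+1 ltac:(lia); lia.
have asc : forall i, k <= i -> i <= t -> c i = c k + (i - k).
  apply: (stretch_increasing cf); [lia|lia| |].
    by move=> i i1 i2; have := cf_rng cf (i := i); lia.
  move=> x x1 x2; have [i [i1 i2 i3]] := sur x ltac:(lia) ltac:(lia).
  exists i; split => //.
  by case: (leqP i t) => // h; have := t4 i h i2; lia.
have et := asc t ltac:(lia) ltac:(lia).
(* Otherwise at least two letters below [c k] end the word, and the positions 1, [k], [c n.-2],
   [c k], with images 2, [c k], [c n.-1], [(c k).+1], form a pattern. *)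
have ck2 : c k = k.+2.
  apply/eqP; apply: contraT => h.
  have g1 := gt n.-2 ltac:(lia) ltac:(lia).
  have g2 := gt n.-1 ltac:(lia) ltac:(lia).
  have s1 := t4 n.-2 ltac:(lia) ltac:(lia).
  have s2 := t4 n.-1 ltac:(lia) ltac:(lia).
  have nn : n.-2.+1 = n.-1 by lia.
  have ck1 := asc k.+1 ltac:(lia) ltac:(lia).
  by have := @cf_4 n c cf 0 k.-1 n.-2 k; rewrite nn kk; lia.
move=> i hi; rewrite /fam1; case: ltnP => ik; first exact: pre.
case: ltnP => it; first by rewrite asc; lia.
by have := gt i ik hi; have := t4 i; lia.
Qed.

End Classification.

(** * Converse: the words of the families satisfy all conditions *)

(* The forbidden pair of patterns depends only on the pairs (x, p x). *)
Lemma cycle_fun_edges (E : nat -> nat -> Prop) n c :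
  c 0 = 1 -> c n = 1 -> (forall i, i < n -> 1 <= c i <= n) ->
  (forall i j, i < j -> j < n -> c i <> c j) ->
  (forall i j k, i < j -> j < k -> k < n -> c j < c i -> c i < c k -> False) ->
  (forall i, i < n -> E (c i) (c i.+1)) ->
  (forall x y z t x' y' z' t', x < y -> y < z -> z < t ->
    x' < z' -> z' < y' -> z' < t' ->
    E z z' -> E x x' -> E y y' -> E t t' -> False) ->
  cycle_fun n c.
Proof.
move=> c0 cn rng inj av e1 e2; split=> //.
  move=> i j hi hj e; case: (ltngtP i j) => // h.
    by case: (inj i j).
  by case: (inj j i).
move=> i1 i2 i3 i4 h1 h2 h3 h4 a1 a2 a3 a4 a5 a6.
by apply: (e2 (c i1) (c i2) (c i3) (c i4)) a4 a5 a6 _ _ _ _ => //; apply: e1.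
Qed.

Ltac pick_lia :=
  match goal with
  | |- _ \/ _ => first [by left; lia | right; pick_lia]
  | |- _ => lia
  end.

(** Linear constraints on a position and its image, free of indices, turn the four-point condition
    into a finite case analysis in linear arithmetic. *)
Definition edge1 n k x y :=
  (x < k /\ y = x.+1) \/ x = k /\ (k.+1 < n /\ y = k.+2 \/ k.+1 = n /\ y = n) \/
  (x = k.+1 /\ y = 1) \/ (k.+1 < x < n /\ y = x.+1) \/
  (k.+1 < n /\ x = n /\ y = k.+1).

Lemma fam1_cycle_fun n k c : 2 <= k < n -> c n = 1 ->
  (forall i, i < n -> c i = fam1 n k i) -> cycle_fun n c.
Proof.
move=> hk cn ce.
have sp i : i < n -> i < k /\ c i = i.+1 \/ k <= i < n.-1 /\ c i = i.+2 \/
    i = n.-1 /\ c i = k.+1.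
  move=> hi; rewrite ce // /fam1; iflia.
apply: (@cycle_fun_edges (edge1 n k)) => //.
- by have := sp 0; lia.
- by move=> i hi; have := sp i hi; lia.
- by move=> i j ij jn; have := sp i; have := sp j; lia.
- by move=> i j l ij jl ln; have := sp i; have := sp j; have := sp l; lia.
- move=> i hi; have := sp i hi; rewrite /edge1.
  case: (ltngtP i.+1 n) => h; [|lia|by rewrite h cn; lia].
  by have := sp i.+1; lia.
- move=> x y z t x' y' z' t' ? ? ? ? ? ? Ez Ex Ey Et.
  case: Ez => [|[|[|[|]]]] ?; try lia; case: Ex => [|[|[|[|]]]] ?; try lia;
  case: Ey => [|[|[|[|]]]] ?; try lia; case: Et => [|[|[|[|]]]] ?; lia.
Qed.

(** In the zigzag, a letter and its successor add up to [(n + k).+1] after a large letter and to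
    [n + k] after a small one. Which letter goes to 1 depends on parity; allowing all letters above
    [k] is harmless, since an image 1 fits only the first letter of a pattern. *)
Definition edge2 n k x y :=
  x < k /\ y = x.+1 \/ x = k /\ y = n \/ k < x /\ y = 1 \/
  (k < x /\ k < y) /\ (x + y = n + k \/ x + y = (n + k).+1 /\ n + k < 2 * x).

Lemma fam2_cycle_fun n k c : 2 <= k -> k.+3 <= n -> c n = 1 ->
  (forall i, i < n -> c i = fam2 n k i) -> cycle_fun n c.
Proof.
move=> hk hk' cn ce.
have sp i : i < n -> i < k /\ c i = i.+1 \/ k <= i /\ 2 * n + k = i + 2 * c i \/
    k <= i /\ 2 * c i = (i + k).+1.
  move=> hi; rewrite ce // /fam2; case: ltnP => ik; first by left.
  have := odd_double_half (i - k); case: ifP => _ e.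
    by right; right; lia.
  by right; left; lia.
apply: (@cycle_fun_edges (edge2 n k)) => //.
- by have := sp 0; lia.
- by move=> i hi; have := sp i hi; lia.
- by move=> i j ij jn; have := sp i; have := sp j; lia.
- by move=> i j l ij jl ln; have := sp i; have := sp j; have := sp l; lia.
- move=> i hi; have := sp i hi; rewrite /edge2.
  case: (ltngtP i.+1 n) => h; [|lia|by rewrite h cn; lia].
  by have := sp i.+1; lia.
- move=> x y z t x' y' z' t' ? ? ? ? ? ? Ez Ex Ey Et.
  case: Ez => [|[|[|]]] ?; try lia; case: Ex => [|[|[|]]] ?; try lia;
  case: Ey => [|[|[|]]] ?; try lia; case: Et => [|[|[|]]] ?; lia.
Qed.

Definition edge3 n j r x y :=
  (x = 1 /\ y = j) \/ (j <= x < n /\ y = x.+1) \/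
  (x = n /\ r < j /\ y = j.-1) \/ (x = n /\ r = j /\ y = 2) \/
  (r < x < j /\ y = x.-1) \/ (x = r /\ r < j /\ y = 2) \/
  (2 <= x /\ x.+1 < r /\ y = x.+1) \/ (x = r.-1 /\ y = 1).

Lemma fam3_cycle_fun n j r c : 3 <= r <= j -> j <= n -> r < n -> c n = 1 ->
  (forall i, i < n -> c i = fam3 n j r i) -> cycle_fun n c.
Proof.
move=> hr hj rn cn ce.
have sp i : i < n -> i = 0 /\ c i = 1 \/ (1 <= i <= (n - j).+1 /\ c i = (j + i).-1) \/
   ((n - j).+1 < i <= (n - r).+1 /\ c i = n.+1 - i) \/
   ((n - r).+1 < i /\ c i = i - (n - r)).
  move=> hi; rewrite ce // /fam3; iflia.
apply: (@cycle_fun_edges (edge3 n j r)) => //.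
- by have := sp 0; lia.
- by move=> i hi; have := sp i hi; lia.
- by move=> i u ij jn; have := sp i; have := sp u; lia.
- move=> i u l ij jl ln; move: (sp i ltac:(lia)) (sp u ltac:(lia)) (sp l ln).
  by case=> [|[|[|]]] ? [|[|[|]]] ?; try lia; case=> [|[|[|]]] ?; lia.
- move=> i hi; rewrite /edge3.
  case: (ltngtP i.+1 n) => h; [|lia|].
    by move: (sp i hi) (sp i.+1 h); case=> [|[|[|]]] ? [|[|[|]]] ?; first [exfalso; lia | pick_lia].
  by rewrite h cn; move: (sp i hi); case=> [|[|[|]]] ?; first [exfalso; lia | pick_lia].
- move=> x y z t x' y' z' t' ? ? ? ? ? ? Ez Ex Ey Et.
  case: Ez => [|[|[|[|[|[|[|]]]]]]] ?; try lia; case: Ex => [|[|[|[|[|[|[|]]]]]]] ?; try lia;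
  case: Ey => [|[|[|[|[|[|[|]]]]]]] ?; try lia; case: Et => [|[|[|[|[|[|[|]]]]]]] ?; lia.
Qed.

Definition edge4 n j r x y :=
  (x = 1 /\ y = j) \/ (j <= x < n /\ y = x.+1) \/
  (x = n /\ y = 2) \/ (x = 2 /\ y = j.-1) \/
  (r < x < j /\ y = x.-1) \/ (x = r /\ y = 3) \/
  (3 <= x /\ x.+1 < r /\ y = x.+1) \/ (x = r.-1 /\ y = 1).

Lemma fam4_cycle_fun n j r c : 4 <= r < j -> j < n -> c n = 1 ->
  (forall i, i < n -> c i = fam4 n j r i) -> cycle_fun n c.
Proof.
move=> hr hj cn ce.
have sp i : i < n -> i = 0 /\ c i = 1 \/ (1 <= i <= (n - j).+1 /\ c i = (j + i).-1) \/
   (i = (n - j).+2 /\ c i = 2) \/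
   ((n - j).+2 < i <= (n - r).+2 /\ c i = n.+2 - i) \/
   ((n - r).+2 < i /\ c i = i - (n - r)).
  move=> hi; rewrite ce // /fam4; iflia.
apply: (@cycle_fun_edges (edge4 n j r)) => //.
- by have := sp 0; lia.
- by move=> i hi; have := sp i hi; lia.
- by move=> i u ij jn; have := sp i; have := sp u; lia.
- move=> i u l ij jl ln; move: (sp i ltac:(lia)) (sp u ltac:(lia)) (sp l ln).
  by case=> [|[|[|[|]]]] ? [|[|[|[|]]]] ?; try lia; case=> [|[|[|[|]]]] ?; lia.
- move=> i hi; rewrite /edge4.
  case: (ltngtP i.+1 n) => h; [|lia|].
    by move: (sp i hi) (sp i.+1 h); case=> [|[|[|[|]]]] ? [|[|[|[|]]]] ?; first [exfalso; lia | pick_lia].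
  by rewrite h cn; move: (sp i hi); case=> [|[|[|[|]]]] ?; first [exfalso; lia | pick_lia].
- move=> x y z t x' y' z' t' ? ? ? ? ? ? Ez Ex Ey Et.
  case: Ez => [|[|[|[|[|[|[|]]]]]]] ?; try lia; case: Ex => [|[|[|[|[|[|[|]]]]]]] ?; try lia;
  case: Ey => [|[|[|[|[|[|[|]]]]]]] ?; try lia; case: Et => [|[|[|[|[|[|[|]]]]]]] ?; lia.
Qed.

(** * Inserting and deleting the letters n and 2 of the prefix 1, n, 2 *)

Lemma cycle_fun_extend n c c' : c n = 1 -> c' 0 = 1 -> c' 1 = n.+2 -> c' n.+2 = 1 ->
  (forall i, i < n -> c' i.+2 = (c i).+1) -> cycle_fun n c -> cycle_fun n.+2 c'.
Proof.
move=> cn c0' c1' cn' ce cf.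
have sp i : i < n.+2 -> i = 0 /\ c' i = 1 \/ i = 1 /\ c' i = n.+2 \/
    (2 <= i /\ c' i = (c i.-2).+1 /\ 1 <= c i.-2 <= n).
  move=> hi; case: i hi => [|[|i]] hi; [by left|by right; left|right; right].
  by rewrite ce //=; have := cf_rng cf (i := i); lia.
split=> //.
- by move=> i hi; have := sp i hi; lia.
- move=> i j hi hj; have := sp i hi; have := sp j hj.
  by have := @cf_inj n c cf i.-2 j.-2; lia.
- move=> i j k ij jk kn; have := sp i; have := sp j; have := sp k.
  by have := @cf_213 n c cf i.-2 j.-2 k.-2; lia.
(* The closing 1 is the only image that is not shifted by one. *)
have ed i : i < n.+2 -> 2 <= i ->
    (c' i.+1 = 1 /\ c i.-2.+1 = 1) \/ (c' i.+1 = (c i.-2.+1).+1 /\ 1 < c i.-2.+1).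
  move=> hi i2; case: (ltngtP i.+1 n.+2) => h; [|lia|].
    right; case: i hi i2 h => [|[|i]] //= hi i2 h; rewrite ce //.
    by split=> //; apply: (cf_gt1 cf).
  by left; rewrite h cn'; split=> //; have -> : i.-2.+1 = n by lia.
have pos i : i < n -> 1 <= c i.+1.
  move=> hi; case: (ltngtP i.+1 n) => h; [|lia|by rewrite h cn].
  by have := cf_rng cf h; lia.
have s2 : 0 < n -> c' 2 = 2 by move=> n0; rewrite ce // (cf_0 cf).
move=> i1 i2 i3 i4 h1 h2 h3 h4.
have S1 := sp i1 h1; have S2 := sp i2 h2; have S3 := sp i3 h3; have S4 := sp i4 h4.
move=> a1 a2 a3 a4 a5 a6.
have g3 : 2 <= i3 by lia.
have g2 : 2 <= i2 by lia.
(* Index 0 carries the letter 1, whose image [n.+2] is too large to be the smallest of four. *)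
have g1 : 2 <= i1.
  case: (ltngtP i1 1) => [i10|//|e]; last by lia.
  move: a4 a5; have -> : i1 = 0 by lia.
  rewrite c1'; case: (ltngtP i3.+1 n.+2) => h; [|lia|by rewrite h cn'; lia].
  by have := sp _ h; lia.
have E1 := ed i1 h1 g1; have E2 := ed i2 h2 g2; have E3 := ed i3 h3 g3.
have P1 := pos i1.-2 ltac:(lia); have P3 := pos i3.-2 ltac:(lia).
case: (leqP 2 i4) => g4.
  have E4 := ed i4 h4 g4.
  by apply: (@cf_4 n c cf i1.-2 i2.-2 i3.-2 i4.-2); lia.
(* Index 1 carries [n.+2], whose image 2 would have to exceed two different images. *)
have i41 : i4 = 1 by lia.
subst i4.
by rewrite s2 in a6; lia.
Qed.

Lemma cycle_fun_restrict n c c' : c n = 1 -> c' 0 = 1 -> c' 1 = n.+2 ->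
  c' n.+2 = 1 -> 0 < n -> c 0 = 1 ->
  (forall i, i < n -> c' i.+2 = (c i).+1) -> cycle_fun n.+2 c' -> cycle_fun n c.
Proof.
move=> cn c0' c1' cn' n0 c0 ce cf.
have rng i : i < n -> 1 <= c i <= n.
  move=> hi; have := ce i hi; have := @cf_rng _ _ cf i.+2.
  have := @cf_neq _ _ cf i.+2 1; have := @cf_gt1 _ _ cf i.+2; lia.
have ed i : i < n -> (c' i.+3 = 1 /\ c i.+1 = 1) \/ (c' i.+3 = (c i.+1).+1 /\ 1 < c i.+1).
  move=> hi; case: (ltngtP i.+1 n) => h; [|lia|].
    right; split; first by rewrite ce.
    by have := @cf_neq _ _ cf i.+3 2; rewrite !ce //; have := rng _ h; lia.
  by left; rewrite h cn' cn.
have pos i : i < n -> 1 <= c i.+1.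
  move=> hi; case: (ltngtP i.+1 n) => h; [|lia|by rewrite h cn].
  by have := rng _ h; lia.
split=> //.
- move=> i j hi hj e; have := @cf_inj _ _ cf i.+2 j.+2.
  by rewrite !ce // e; lia.
- move=> i j k ij jk kn.
  by have := @cf_213 _ _ cf i.+2 j.+2 k.+2; rewrite !ce; lia.
move=> i1 i2 i3 i4 h1 h2 h3 h4 a1 a2 a3 a4 a5 a6.
have := @cf_4 _ _ cf i1.+2 i2.+2 i3.+2 i4.+2; rewrite !(ce i1, ce i2, ce i3, ce i4) //.
have := ed _ h1; have := ed _ h2; have := ed _ h3; have := ed _ h4.
by have := pos _ h1; lia.
Qed.

(** * Enumeration of the good words *)

(* The default value 1 of [nth] is the letter that follows the last one in the cycle. *)
Definition good_word n w := size w = n /\ cycle_fun n (nth 1 w).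

(** The ranges avoid double counting: [fam2] stops at [k = n - 3], before it meets [fam1], and
    [fam3] with [j = n] omits [r = n], whose word starts with 1, n, 2 and belongs to the recursive
    part. *)
Definition fam_words n :=
  [seq mkseq (fam1 n k) n | k <- iota 2 (n - 2)] ++
  [seq mkseq (fam2 n k) n | k <- iota 2 (n - 4)] ++
  [seq mkseq (fam3 n n r) n | r <- iota 3 (n - 3)] ++
  [seq mkseq (fam3 n j r) n | j <- iota 3 (n - 3), r <- iota 3 (j - 2)] ++
  [seq mkseq (fam4 n j r) n | j <- iota 3 (n - 3), r <- iota 4 (j - 4)].

Definition extend_word n w : seq nat := [:: 1, n.+2 & map succn w].

Fixpoint good_words n :=
  match n with
  | 0 | 1 | 2 => [:: iota 1 n]
  | (m.+1 as m').+2 => [seq extend_word m' w | w <- good_words m'] ++ fam_words m'.+2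
  end.

Lemma mkseq_eqP (f : nat -> nat) n w :
  reflect (size w = n /\ forall i, i < n -> nth 1 w i = f i) (w == mkseq f n).
Proof.
apply: (iffP eqP) => [->|[sw e]].
  by rewrite size_mkseq; split=> // i hi; rewrite nth_mkseq.
apply: (@eq_from_nth _ 1); first by rewrite size_mkseq.
by rewrite sw => i hi; rewrite nth_mkseq // e.
Qed.

Lemma mkseq_eq_at (f g : nat -> nat) n i : i < n -> mkseq f n = mkseq g n -> f i = g i.
Proof. by move=> hi /(congr1 (fun w => nth 1 w i)); rewrite !nth_mkseq. Qed.

Lemma mem_fam_words n w : 3 <= n -> w \in fam_words n <->
  [\/ exists2 k, 2 <= k < n & w = mkseq (fam1 n k) n,
      exists2 k, 2 <= k <= n - 3 & w = mkseq (fam2 n k) n,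
      exists2 r, 3 <= r < n & w = mkseq (fam3 n n r) n |
      (exists j r, [/\ 3 <= j < n, 3 <= r <= j & w = mkseq (fam3 n j r) n]) \/
      (exists j r, [/\ j < n, 4 <= r < j & w = mkseq (fam4 n j r) n])].
Proof.
move=> n3; rewrite !mem_cat; split.
  case/or4P => [/mapP|/mapP|/mapP|/orP [/allpairsPdep|/allpairsPdep]].
  - by case=> k; rewrite mem_iota => hk ->; constructor 1; exists k => //; lia.
  - by case=> k; rewrite mem_iota => hk ->; constructor 2; exists k => //; lia.
  - by case=> k; rewrite mem_iota => hk ->; constructor 3; exists k => //; lia.
  - case=> j [r [hj hr ->]]; rewrite !mem_iota in hj hr; constructor 4; left.
    by exists j, r; split => //; lia.
  - case=> j [r [hj hr ->]]; rewrite !mem_iota in hj hr; constructor 4; right.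
    by exists j, r; split => //; lia.
case=> [[k hk ->]|[k hk ->]|[k hk ->]|[[j [r [hj hr ->]]]|[j [r [hj hr ->]]]]]; apply/or4P.
- by constructor 1; apply/mapP; exists k => //; rewrite mem_iota; lia.
- by constructor 2; apply/mapP; exists k => //; rewrite mem_iota; lia.
- by constructor 3; apply/mapP; exists k => //; rewrite mem_iota; lia.
- constructor 4; apply/orP; left; apply/allpairsPdep; exists j, r.
  by rewrite !mem_iota; split=> //; lia.
- constructor 4; apply/orP; right; apply/allpairsPdep; exists j, r.
  by rewrite !mem_iota; split=> //; lia.
Qed.

Lemma good_fam_words n w : 3 <= n -> w \in fam_words n -> good_word n w.
Proof.
move=> n3 /(mem_fam_words _ n3) H.
have cn f : nth 1 (mkseq f n) n = 1 by rewrite nth_default ?size_mkseq.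
case: H => [[k hk ->]|[k hk ->]|[k hk ->]|[[j [r [hj hr ->]]]|[j [r [hj hr ->]]]]];
  split; rewrite ?size_mkseq //.
- by apply: fam1_cycle_fun hk _ _ => // i hi; rewrite nth_mkseq.
- by apply: (@fam2_cycle_fun n k) => //; try lia; move=> i hi; rewrite nth_mkseq.
- by apply: (@fam3_cycle_fun n n k) => //; try lia; move=> i hi; rewrite nth_mkseq.
- by apply: (@fam3_cycle_fun n j r) => //; try lia; move=> i hi; rewrite nth_mkseq.
- by apply: (@fam4_cycle_fun n j r) => //; try lia; move=> i hi; rewrite nth_mkseq.
Qed.

Lemma fam_words_good n w : 3 <= n -> good_word n w ->
  w \in fam_words n \/ nth 1 w 1 = n /\ nth 1 w 2 = 2.
Proof.
move=> n3 [sw cf].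
have E f : (forall i, i < n -> nth 1 w i = f i) -> w = mkseq f n.
  by move=> h; apply/eqP/mkseq_eqP.
have g1 := @cf_gt1 _ _ cf 1 isT ltac:(lia).
have r1 := @cf_rng _ _ cf 1 ltac:(lia).
case: (ltngtP (nth 1 w 1) 2) => h; first by lia.
  case: (ltngtP (nth 1 w 1) n) => h'; last first.
  - case: (nth 1 w 2 =P 2) => h2; [by right|left].
    apply/mem_fam_words => //; constructor 3.
    by have [r hr /E e] := second_max cf n3 h' h2; exists r.
  - by lia.
  left; apply/mem_fam_words => //; constructor 4.
  have [] := second_middle cf; first by lia.
    by case=> r hr /E e; left; exists (nth 1 w 1), r; split=> //; lia.
  by case=> r hr /E e; right; exists (nth 1 w 1), r; split=> //; lia.
left; apply/mem_fam_words => //.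
case: (second_two cf n3 h) => [[k hk /E e]|[k hk [hk' /E e]]].
  by constructor 1; exists k.
by constructor 2; exists k => //; lia.
Qed.

Lemma nth_extend_word n w i : size w = n ->
  nth 1 (extend_word n w) i.+2 = if i < n then (nth 1 w i).+1 else 1.
Proof.
move=> sw /=; case: ltnP => h; first by rewrite (nth_map 1) ?sw.
by rewrite nth_default ?size_map ?sw.
Qed.

Lemma good_extend_word n w : good_word n w -> good_word n.+2 (extend_word n w).
Proof.
case=> sw cf; split; first by rewrite /= size_map sw.
apply: (cycle_fun_extend _ _ _ _ _ cf) => //.
- exact: (cf_n cf).
- by rewrite nth_extend_word // ltnn.
- by move=> i hi; rewrite nth_extend_word // hi.
Qed.

Lemma good_word_extend n w : 0 < n -> good_word n.+2 w ->
  nth 1 w 1 = n.+2 -> nth 1 w 2 = 2 ->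
  exists2 v, good_word n v & w = extend_word n v.
Proof.
move=> n0 [sw cf] w1 w2.
pose v := mkseq (fun i => (nth 1 w i.+2).-1) n.
have sv : size v = n by rewrite size_mkseq.
have ev i : i < n -> nth 1 w i.+2 = (nth 1 v i).+1.
  by move=> hi; rewrite nth_mkseq //; have := @cf_rng _ _ cf i.+2; lia.
exists v; last first.
  apply: (@eq_from_nth _ 1); first by rewrite sw /= size_map sv.
  rewrite sw; case=> [|[|i]] hi; [exact: (cf_0 cf)|exact: w1|].
  by rewrite nth_extend_word // ev // ifT.
split=> //; apply: (cycle_fun_restrict _ _ w1 _ n0 _ ev cf).
- by rewrite nth_default ?sv.
- exact: (cf_0 cf).
- exact: (cf_n cf).
- by rewrite nth_mkseq // w2.
Qed.

Lemma good_wordsP n w : 0 < n -> (w \in good_words n) <-> good_word n w.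
Proof.
elim/ltn_ind: n w => -[|[|[|n]]] // IH w _.
- rewrite inE; split=> [/eqP ->|[sw cf]].
    split=> //; split=> //; [by case|by case=> [|i] [|j]|lia|].
    by move=> [|i1] [|i2].
  case: w sw cf => [|x [|y w]] // _ cf; have := cf_0 cf => /= ->; exact: eqxx.
- rewrite inE; split=> [/eqP ->|[sw cf]].
    split=> //; split=> //; [by case=> [|[]]|by case=> [|[|i]] [|[|j]]|lia|].
    by move=> [|[|i1]] [|[|i2]] [|[|i3]].
  case: w sw cf => [|x [|y [|z w]]] // _ cf; have := cf_0 cf => /= e.
  have := @cf_rng _ _ cf 1 isT; have := @cf_gt1 _ _ cf 1 isT isT => /= h1 h2.
  by apply/eqP; congr [:: _; _]; lia.
have -> : good_words n.+3 =
  [seq extend_word n.+1 w | w <- good_words n.+1] ++ fam_words n.+3 by [].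
rewrite mem_cat; split.
  case/orP => [/mapP [v vg ->]|/good_fam_words]; last exact.
  by apply: good_extend_word; apply/IH.
move=> gw; case: (fam_words_good _ gw) => // [->|[w1 w2]]; first by rewrite orbT.
have [//|v gv ->] := good_word_extend _ gw w1 w2.
by rewrite map_f //; apply/IH.
Qed.

(** * Number and distinctness of the listed words *)

Lemma sum_fam_sizes m :
  (m.+1 + (m - 1) + m) + sumn [seq j - 2 | j <- iota 3 m] +
    sumn [seq j - 4 | j <- iota 3 m] = m.+1 ^ 2.
Proof.
elim: m => // m IH; have -> : iota 3 m.+1 = iota 3 m ++ [:: 3 + m].
  by rewrite -[m.+1]addn1 iotaD.
rewrite !map_cat !sumn_cat /= !addn0.
(* The case [m = 0] is separate because [m - 1] is truncated there. *)
move: IH; rewrite !expnS expn0 !muln1; case: m => [|m] IH //; nia.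
Qed.

Lemma size_fam_words m : size (fam_words m.+3) = m.+1 ^ 2.
Proof.
rewrite !size_cat !size_map !size_allpairs_dep !size_iota -sum_fam_sizes.
have e a b : [seq size (iota a (j - b)) | j <- iota 3 (m.+3 - 3)] = [seq j - b | j <- iota 3 m].
  by rewrite !subSS subn0; apply: eq_map => j; rewrite size_iota.
by rewrite !e; lia.
Qed.

(** Two applications of Pascal's rule leave two consecutive triangular numbers, whose sum is the
    square contributed by the families. *)
Lemma size_good_words n : 0 < n -> size (good_words n) = 'C(n, 3) + 1.
Proof.
elim/ltn_ind: n => -[|[|[|n]]] // IH _.
have -> : good_words n.+3 =
  [seq extend_word n.+1 w | w <- good_words n.+1] ++ fam_words n.+3 by [].
rewrite size_cat size_map IH // size_fam_words [in RHS]binS [in RHS]binS.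
rewrite ['C(n.+2, 2)]binS !bin1.
have := mul_bin_diag n.+1 1; rewrite bin1 => e.
rewrite expnS expn1; nia.
Qed.

Lemma disjoint_cat_uniq (T : eqType) (s1 s2 : seq T) : uniq s1 -> uniq s2 ->
  (forall x, x \in s1 -> x \in s2 -> False) -> uniq (s1 ++ s2).
Proof.
move=> u1 u2 d; rewrite cat_uniq u1 u2 andbT /=.
by apply/hasPn => x x2; apply/negP => x1; apply: d x1 x2.
Qed.

Lemma allpairs_uniq_nat (T : eqType) (f : nat -> nat -> T) s t :
  uniq s -> (forall x, uniq (t x)) ->
  (forall x y x' y', x \in s -> y \in t x -> x' \in s -> y' \in t x' ->
    f x y = f x' y' -> x = x' /\ y = y') ->
  uniq [seq f x y | x <- s, y <- t x].
Proof.
move=> us ut inj; apply: allpairs_uniq_dep => //.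
move=> _ _ /allpairsPdep [x [y [xs yt ->]]] /allpairsPdep [x' [y' [xs' yt' ->]]] /= e.
by have [ex ey] := inj _ _ _ _ xs yt xs' yt' e; subst.
Qed.

(** The letter at index 1 is 2, [n] or [j], which separates most pairs; the others are told apart at
    an index where one of the two words changes its regime. *)
Lemma uniq_fam_words n : 3 <= n -> uniq (fam_words n).
Proof.
move=> n3.
have ne1 k k' : k < k' -> k' < n -> mkseq (fam1 n k) n <> mkseq (fam1 n k') n.
  move=> h h' /(mkseq_eq_at (i := k)) e; have {e} := e ltac:(lia).
  by rewrite /fam1; iflia.
have ne2 k k' : k < k' -> k' <= n - 3 -> mkseq (fam2 n k) n <> mkseq (fam2 n k') n.
  move=> h h' /(mkseq_eq_at (i := k)) e; have {e} := e ltac:(lia).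
  by rewrite /fam2 subnn ltnn /= h; lia.
have ne3 j r r' : 3 <= r -> r < r' -> r' <= j -> j <= n ->
    mkseq (fam3 n j r) n <> mkseq (fam3 n j r') n.
  (* At this index the word for [r'] has just dropped to 2, while the one for [r] still descends. *)
  move=> h1 h2 h3 h4 /(mkseq_eq_at (i := (n - r').+2)) e; have {e} := e ltac:(lia).
  by rewrite /fam3; iflia.
have ne4 j r r' : 4 <= r -> r < r' -> r' < j -> j < n ->
    mkseq (fam4 n j r) n <> mkseq (fam4 n j r') n.
  move=> h1 h2 h3 h4 /(mkseq_eq_at (i := (n - r').+3)) e; have {e} := e ltac:(lia).
  by rewrite /fam4; iflia.
have v1 k : 2 <= k -> fam1 n k 1 = 2 by rewrite /fam1; iflia.
have v2 k : 2 <= k -> fam2 n k 1 = 2 by move=> h; rewrite /fam2 ifT.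
have v3 j r : 3 <= j -> fam3 n j r 1 = j by rewrite /fam3 /= addn1.
have v4 j r : 3 <= j -> fam4 n j r 1 = j by rewrite /fam4 /= addn1.
have in1 (f g : nat -> nat) : mkseq f n = mkseq g n -> f 1 = g 1 by apply: mkseq_eq_at; lia.
have ne34 j r r' : 3 <= r <= j -> 4 <= r' < j -> j < n ->
    mkseq (fam3 n j r) n <> mkseq (fam4 n j r') n.
  move=> h1 h2 h3 e.
  (* [fam4] continues with 2, [j.-1] after [n]; [fam3] with [j.-1] or with 2, 3. *)
  have := @mkseq_eq_at _ _ n (n - j).+2 ltac:(lia) e.
  have := @mkseq_eq_at _ _ n (n - j).+3 ltac:(lia) e.
  by rewrite /fam3 /fam4; iflia.
have ne12 k k' : 2 <= k < n -> 2 <= k' <= n - 3 ->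
    mkseq (fam1 n k) n <> mkseq (fam2 n k') n.
  move=> h h' /(mkseq_eq_at (i := k')) e; have {e} := e ltac:(lia).
  by rewrite /fam1 /fam2 ltnn subnn /=; iflia.
apply: disjoint_cat_uniq.
- rewrite map_inj_in_uniq ?iota_uniq // => k k'; rewrite !mem_iota => h h' e.
  by case: (ltngtP k k') => // hk; [case: (ne1 k k')|case: (ne1 k' k)]; rewrite ?e //; lia.
- apply: disjoint_cat_uniq.
  + rewrite map_inj_in_uniq ?iota_uniq // => k k'; rewrite !mem_iota => h h' e.
    by case: (ltngtP k k') => // hk; [case: (ne2 k k')|case: (ne2 k' k)]; rewrite ?e //; lia.
  + apply: disjoint_cat_uniq.
    * rewrite map_inj_in_uniq ?iota_uniq // => k k'; rewrite !mem_iota => h h' e.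
      by case: (ltngtP k k') => // hk; [case: (ne3 n k k')|case: (ne3 n k' k)]; rewrite ?e //; lia.
    * apply: disjoint_cat_uniq.
      -- apply: allpairs_uniq_nat => [|j|j r j' r']; rewrite ?iota_uniq //.
         rewrite !mem_iota => hj hr hj' hr' e.
         have ej : j = j' by have := in1 _ _ e; rewrite !v3; lia.
         subst j'; split=> //.
         by case: (ltngtP r r') => // hk; [case: (ne3 j r r')|case: (ne3 j r' r)]; rewrite ?e //; lia.
      -- apply: allpairs_uniq_nat => [|j|j r j' r']; rewrite ?iota_uniq //.
         rewrite !mem_iota => hj hr hj' hr' e.
         have ej : j = j' by have := in1 _ _ e; rewrite !v4; lia.
         subst j'; split=> //.
         by case: (ltngtP r r') => // hk; [case: (ne4 j r r')|case: (ne4 j r' r)]; rewrite ?e //; lia.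
      -- move=> _ /allpairsPdep [j [r [+ + ->]]] /allpairsPdep [j' [r' [+ +]]].
         rewrite !mem_iota => hj hr hj' hr' e.
         have ej : j = j' by have := in1 _ _ e; rewrite v3 ?v4; lia.
         by subst j'; case: (ne34 j r r') => //; lia.
    * move=> _ /mapP [k + ->]; rewrite mem_cat mem_iota => hk.
      case/orP => /allpairsPdep [j [r []]]; rewrite !mem_iota => hj hr /in1.
        by rewrite !v3; lia.
      by rewrite v3 ?v4; lia.
  + move=> _ /mapP [k + ->]; rewrite !mem_cat mem_iota => hk.
    case/or3P => [/mapP [r]|/allpairsPdep [j [r []]]|/allpairsPdep [j [r []]]];
      rewrite !mem_iota.
    * by move=> hr /in1; rewrite v2 ?v3; lia.
    * by move=> hj hr /in1; rewrite v2 ?v3; lia.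
    * by move=> hj hr /in1; rewrite v2 ?v4; lia.
- move=> _ /mapP [k + ->]; rewrite !mem_cat mem_iota => hk.
  case/or4P => [/mapP [k']|/mapP [r]|/allpairsPdep [j [r []]]|/allpairsPdep [j [r []]]];
    rewrite !mem_iota.
  + by move=> hk' e; case: (ne12 k k') => //; lia.
  + by move=> hr /in1; rewrite v1 ?v3; lia.
  + by move=> hj hr /in1; rewrite v1 ?v3; lia.
  + by move=> hj hr /in1; rewrite v1 ?v4; lia.
Qed.

Lemma uniq_good_words n : uniq (good_words n).
Proof.
elim/ltn_ind: n => -[|[|[|n]]] // IH.
have -> : good_words n.+3 =
  [seq extend_word n.+1 w | w <- good_words n.+1] ++ fam_words n.+3 by [].
apply: disjoint_cat_uniq; last 1 first.
(* Only [fam3] with [j] maximal puts the largest letter at index 1, and there the letter at index 2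
   is not 2. *)
- move=> _ /mapP [v vg ->] /mem_fam_words.
  case: v vg => [|x v].
    by move/good_wordsP => /(_ isT) [].
  move/good_wordsP => /(_ isT) [sv cf].
  have -> : x = 1 by exact: (cf_0 cf).
  set w := extend_word _ _.
  have w1 f : w = mkseq f n.+3 -> f 1 = n.+3 by move=> e; rewrite -(@nth_mkseq _ 1 f n.+3) // -e.
  have w2 f : w = mkseq f n.+3 -> f 2 = 2 by move=> e; rewrite -(@nth_mkseq _ 1 f n.+3) // -e.
  case=> // [[k hk]|[k hk]|[k hk]|[[j [r [hj hr]]]|[j [r [hj hr]]]]].
  + by move/w1; rewrite /fam1; iflia.
  + by move/w1; rewrite /fam2; case: ifP; lia.
  + by move/w2; rewrite /fam3; iflia.
  + by move/w1; rewrite /fam3 /= addn1; lia.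
  + by move/w1; rewrite /fam4 /= addn1; lia.
- rewrite map_inj_in_uniq ?IH // => v v' _ _ [].
  by apply: inj_map => x y [].
- exact: uniq_fam_words.
Qed.

(** * Pattern containment in terms of positions *)

Lemma containsP w sigma :
  reflect (exists2 g : nat -> nat, forall s, s < size sigma -> g s < size w &
    forall s t, s < t -> t < size sigma -> g s < g t /\
      (nth 0 w (g t) < nth 0 w (g s)) = (nth 0 sigma t < nth 0 sigma s))
  (contains w sigma).
Proof.
apply: (iffP existsP) => [[f /forallP H]|[g g1 g2]].
  exists (fun s => if insub s is Some s' then f s' : nat else 0).
    by move=> s hs; rewrite insubT.
  move=> s t st ht; have hs := ltn_trans st ht.
  rewrite !insubT /=; have /forallP/(_ (Sub t ht)) := H (Sub s hs).
  by move/implyP => /(_ st) /andP [h /eqP].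
exists [ffun s => Ordinal (g1 _ (ltn_ord s))].
apply/forallP => s; apply/forallP => t; apply/implyP => st.
rewrite !ffunE /=; have [-> ->] := g2 _ _ st (ltn_ord t).
by rewrite eqxx.
Qed.

Lemma contains3P w a b c :
  contains w [:: a; b; c] <->
  exists i j k, [/\ i < j, j < k, k < size w &
    [/\ (nth 0 w j < nth 0 w i) = (b < a), (nth 0 w k < nth 0 w i) = (c < a) &
        (nth 0 w k < nth 0 w j) = (c < b)]].
Proof.
split=> [/containsP [g g1 g2]|[i [j [k [h1 h2 h3 [e1 e2 e3]]]]]].
  exists (g 0), (g 1), (g 2).
  have [? ?] := g2 0 1 isT isT; have [? ?] := g2 0 2 isT isT.
  by have [? ?] := g2 1 2 isT isT; have ? := g1 2 isT; split.
apply/containsP; exists (nth 0 [:: i; j; k]).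
  by case=> [|[|[|s]]] //= _; lia.
by case=> [|[|[|s]]] [|[|[|t]]] //= _ _; split=> //; lia.
Qed.

Lemma contains4P w a b c d :
  contains w [:: a; b; c; d] <->
  exists i j k l, [/\ i < j, j < k, k < l, l < size w &
    [/\ (nth 0 w j < nth 0 w i) = (b < a), (nth 0 w k < nth 0 w i) = (c < a) &
        (nth 0 w l < nth 0 w i) = (d < a)] /\
    [/\ (nth 0 w k < nth 0 w j) = (c < b), (nth 0 w l < nth 0 w j) = (d < b) &
        (nth 0 w l < nth 0 w k) = (d < c)]].
Proof.
split=> [/containsP [g g1 g2]|[i [j [k [l [h1 h2 h3 h4 [[e1 e2 e3] [e4 e5 e6]]]]]]]].
  exists (g 0), (g 1), (g 2), (g 3).
  have [? ?] := g2 0 1 isT isT; have [? ?] := g2 0 2 isT isT.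
  have [? ?] := g2 0 3 isT isT; have [? ?] := g2 1 2 isT isT.
  have [? ?] := g2 1 3 isT isT; have [? ?] := g2 2 3 isT isT.
  by have ? := g1 3 isT; split.
apply/containsP; exists (nth 0 [:: i; j; k; l]).
  by case=> [|[|[|[|s]]]] //= _; lia.
by case=> [|[|[|[|s]]]] [|[|[|[|t]]]] //= _ _; split=> //; lia.
Qed.

Section OneLine.

Variables (n : nat) (p : 'S_n).

Lemma size_one_line : size (one_line p) = n.
Proof. by rewrite size_map size_enum_ord. Qed.

Lemma nth_one_line (i : 'I_n) : nth 0 (one_line p) i = (p i).+1.
Proof. by rewrite (nth_map i) ?size_enum_ord // nth_ord_enum. Qed.

Lemma one_line_contains a b c d :
  contains (one_line p) [:: a; b; c; d] <->
  exists i j k l : 'I_n, [/\ i < j, j < k, k < l &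
    [/\ (p j < p i) = (b < a), (p k < p i) = (c < a) & (p l < p i) = (d < a)] /\
    [/\ (p k < p j) = (c < b), (p l < p j) = (d < b) & (p l < p k) = (d < c)]].
Proof.
rewrite contains4P size_one_line; split.
  case=> i [j [k [l [h1 h2 h3 h4 H]]]].
  have [hi hj hk] : [/\ i < n, j < n & k < n] by split; lia.
  exists (Ordinal hi), (Ordinal hj), (Ordinal hk), (Ordinal h4); split=> //.
  move: H; rewrite -[i]/(nat_of_ord (Ordinal hi)) -[j]/(nat_of_ord (Ordinal hj)).
  rewrite -[k]/(nat_of_ord (Ordinal hk)) -[l]/(nat_of_ord (Ordinal h4)).
  by rewrite !nth_one_line !ltnS.
case=> i [j [k [l [h1 h2 h3 H]]]]; exists i, j, k, l; split=> //.
by rewrite !nth_one_line !ltnS.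
Qed.

End OneLine.

Lemma contains_1324 n (p : 'S_n) : contains (one_line p) [:: 1; 3; 2; 4] <->
  exists i j k l : 'I_n, [/\ i < j, j < k & k < l] /\ [/\ p i < p k, p k < p j & p j < p l].
Proof.
rewrite one_line_contains; split.
  case=> i [j [k [l [h1 h2 h3 [[e1 e2 e3] [e4 e5 e6]]]]]]; exists i, j, k, l; split=> //.
  (* Equal truth values give only weak inequalities; injectivity of [p] makes them strict. *)
  have : p i != p k by rewrite (inj_eq perm_inj) -val_eqE /=; lia.
  have : p j != p l by rewrite (inj_eq perm_inj) -val_eqE /=; lia.
  by rewrite -!val_eqE /=; split; lia.
by case=> i [j [k [l [[h1 h2 h3] [e1 e2 e3]]]]]; exists i, j, k, l; split=> //; split; split; lia.
Qed.

Lemma contains_1423 n (p : 'S_n) : contains (one_line p) [:: 1; 4; 2; 3] <->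
  exists i j k l : 'I_n, [/\ i < j, j < k & k < l] /\ [/\ p i < p k, p k < p l & p l < p j].
Proof.
rewrite one_line_contains; split.
  case=> i [j [k [l [h1 h2 h3 [[e1 e2 e3] [e4 e5 e6]]]]]]; exists i, j, k, l; split=> //.
  have : p i != p k by rewrite (inj_eq perm_inj) -val_eqE /=; lia.
  have : p k != p l by rewrite (inj_eq perm_inj) -val_eqE /=; lia.
  by rewrite -!val_eqE /=; split; lia.
by case=> i [j [k [l [[h1 h2 h3] [e1 e2 e3]]]]]; exists i, j, k, l; split=> //; split; split; lia.
Qed.

Lemma contains_1342 n (p : 'S_n) : contains (one_line p) [:: 1; 3; 4; 2] <->
  exists i j k l : 'I_n, [/\ i < j, j < k & k < l] /\ [/\ p i < p l, p l < p j & p j < p k].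
Proof.
rewrite one_line_contains; split.
  case=> i [j [k [l [h1 h2 h3 [[e1 e2 e3] [e4 e5 e6]]]]]]; exists i, j, k, l; split=> //.
  have : p i != p l by rewrite (inj_eq perm_inj) -val_eqE /=; lia.
  have : p j != p k by rewrite (inj_eq perm_inj) -val_eqE /=; lia.
  by rewrite -!val_eqE /=; split; lia.
by case=> i [j [k [l [[h1 h2 h3] [e1 e2 e3]]]]]; exists i, j, k, l; split=> //; split; split; lia.
Qed.

Lemma contains_1324V n (p : 'S_n) :
  contains (one_line p) [:: 1; 3; 2; 4] -> contains (one_line p^-1) [:: 1; 3; 2; 4].
Proof.
case/contains_1324 => i [j [k [l [[h1 h2 h3] [e1 e2 e3]]]]]; apply/contains_1324.
by exists (p i), (p k), (p j), (p l); rewrite !permK.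
Qed.

Lemma contains_1423V n (p : 'S_n) :
  contains (one_line p) [:: 1; 4; 2; 3] <-> contains (one_line p^-1) [:: 1; 3; 4; 2].
Proof.
split.
  case/contains_1423 => i [j [k [l [[h1 h2 h3] [e1 e2 e3]]]]]; apply/contains_1342.
  by exists (p i), (p k), (p l), (p j); rewrite !permK.
case/contains_1342 => i [j [k [l [[h1 h2 h3] [e1 e2 e3]]]]]; apply/contains_1423.
exists (p^-1%g i), (p^-1%g l), (p^-1%g j), (p^-1%g k); rewrite !permKV; split; split=> //; lia.
Qed.

(** * Cyclic permutations and their cycle forms *)

Section CycleForm.

Variables (m : nat) (p : 'S_m.+1).

Lemma cycle_formE : cycle_form p = [seq (i : nat).+1 | i : 'I_m.+1 <- traject p ord0 m.+1].
Proof.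
by rewrite /cycle_form; case: insubP => // u _ u0; rewrite (_ : u = ord0) //; apply: val_inj.
Qed.

Lemma size_cycle_form : size (cycle_form p) = m.+1.
Proof. by rewrite cycle_formE size_map size_traject. Qed.

Lemma nth_cycle_form x0 i : i <= m ->
  nth x0 (cycle_form p) i = (iter i p ord0).+1.
Proof.
by move=> hi; rewrite cycle_formE (nth_map ord0) ?size_traject // nth_traject.
Qed.

Lemma cyclic_porbit : is_cyclic_perm p -> porbit p ord0 = setT.
Proof.
move/eqP => e; have : porbit p ord0 \in porbits p by apply: imset_f.
by rewrite e => /set1P.
Qed.

Lemma cyclic_iter : is_cyclic_perm p -> iter m.+1 p ord0 = ord0.
Proof.
by move/cyclic_porbit => e; have := iter_porbit p ord0; rewrite e cardsT card_ord.
Qed.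

Lemma cyclic_iter_inj i j : is_cyclic_perm p -> i <= m -> j <= m ->
  iter i p ord0 = iter j p ord0 -> i = j.
Proof.
move/cyclic_porbit => e hi hj h.
have := uniq_traject_porbit p ord0; rewrite e cardsT card_ord.
move/(uniqP ord0) => /(_ i j); rewrite !inE size_traject => /(_ hi hj); apply.
by rewrite !nth_traject.
Qed.

Lemma cyclic_iter_sur x : is_cyclic_perm p -> exists2 i, i <= m & iter i p ord0 = x.
Proof.
move/cyclic_porbit => e; have := porbit_traject p ord0 x.
by rewrite e cardsT card_ord inE => /esym/trajectP [i hi ->]; exists i.
Qed.

Lemma cyclic_permP : (forall x, exists i, iter i p ord0 = x) -> is_cyclic_perm p.
Proof.
move=> sur; apply/eqP/setP => A; rewrite inE.
have all x : porbit p x = setT.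
  apply/setP => y; rewrite inE.
  have [i <-] := sur y; have [j <-] := sur x.
  by rewrite -!permX -eq_porbit_mem !porbit_perm eqxx.
apply/imsetP/eqP => [[x _ ->]|->]; first exact: all.
by exists ord0; rewrite ?all.
Qed.

Lemma cyclic_contains_213 : is_cyclic_perm p ->
  contains (cycle_form p) [:: 2; 1; 3] <->
  exists i j k, [/\ i < j, j < k, k <= m,
    iter j p ord0 < iter i p ord0 & iter i p ord0 < iter k p ord0].
Proof.
move=> cp; rewrite contains3P size_cycle_form; split=> -[i [j [k []]]] h1 h2 h3.
  rewrite !nth_cycle_form ?ltnS; try lia; case=> e1 e2 e3; exists i, j, k; split=> //; try lia.
  rewrite ltn_neqAle; apply/andP; split; last by lia.
  by apply/eqP => /val_inj /(cyclic_iter_inj cp); lia.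
by move=> e1 e2; exists i, j, k; rewrite !nth_cycle_form ?ltnS; try lia; split=> //; split; lia.
Qed.

Lemma cyclic_contains_312 : is_cyclic_perm p ->
  contains (cycle_form p) [:: 3; 1; 2] <->
  exists i j k, [/\ i < j, j < k, k <= m,
    iter j p ord0 < iter k p ord0 & iter k p ord0 < iter i p ord0].
Proof.
move=> cp; rewrite contains3P size_cycle_form; split=> -[i [j [k []]]] h1 h2 h3.
  rewrite !nth_cycle_form ?ltnS; try lia; case=> e1 e2 e3; exists i, j, k; split=> //; try lia.
  rewrite ltn_neqAle; apply/andP; split; last by lia.
  by apply/eqP => /val_inj /(cyclic_iter_inj cp); lia.
by move=> e1 e2; exists i, j, k; rewrite !nth_cycle_form ?ltnS; try lia; split=> //; split; lia.
Qed.

Lemma iter_cyclicV i : is_cyclic_perm p -> i <= m.+1 ->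
  iter i (p^-1)%g ord0 = iter (m.+1 - i) p ord0.
Proof.
move=> cp; elim: i => [|i IH] hi; first by rewrite subn0 cyclic_iter.
rewrite iterS IH; last by lia.
by rewrite (_ : m.+1 - i = (m.+1 - i.+1).+1) ?iterS ?permK //; lia.
Qed.

Lemma is_cyclic_permV : is_cyclic_perm (p^-1)%g = is_cyclic_perm p.
Proof. by rewrite /is_cyclic_perm porbitsV. Qed.

Lemma nth_cycle_form_full i : is_cyclic_perm p -> i <= m.+1 ->
  nth 1 (cycle_form p) i = (iter i p ord0).+1.
Proof.
move=> cp; rewrite leq_eqVlt => /orP [/eqP ->|]; last exact: nth_cycle_form.
by rewrite nth_default ?size_cycle_form // cyclic_iter.
Qed.

Lemma mem_A_set_good : is_cyclic_perm p ->
  (p \in A_set m.+1 [:: [:: 1; 3; 2; 4]; [:: 1; 4; 2; 3]] [:: 2; 1; 3]) <->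
  good_word m.+1 (cycle_form p).
Proof.
move=> cp; rewrite inE cp /= andbT.
have ce i := @nth_cycle_form_full i cp.
split=> [/andP [/andP [n1 n2] n3]|[_ cf]].
  split; first exact: size_cycle_form.
  split.
  - by rewrite ce.
  - by rewrite ce // cyclic_iter.
  - by move=> i hi; rewrite ce ?ltn_ord // ltnW.
  - move=> i j hi hj; rewrite !ce; try lia.
    by case=> /val_inj; apply: cyclic_iter_inj.
  - move=> i j k ij jk kn; rewrite !ce; try lia.
    move=> h1 h2; apply: (negP n3); apply/cyclic_contains_213 => //.
    by exists i, j, k.
  - move=> i1 i2 i3 i4 h1 h2 h3 h4.
    rewrite !ce; try lia.
    rewrite !ltnS !iterS => a1 a2 a3 a4 a5 a6.
    set b := iter i2 p ord0 in a1 a2 a5; set d := iter i4 p ord0 in a3 a6.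
    (* The order of the two largest images, left open in [cf_4], decides between 1324 and 1423. *)
    case: (ltngtP (p b) (p d)) => [bd|db|].
    + by apply: (negP n1); apply/contains_1324; exists (iter i1 p ord0), b, (iter i3 p ord0), d.
    + by apply: (negP n2); apply/contains_1423; exists (iter i1 p ord0), b, (iter i3 p ord0), d.
    + by move/val_inj/perm_inj => e; rewrite e in a2; lia.
(* [cf_4] speaks of indices in the cycle, so each position is first written as an iterate of [p] at
   [ord0]. *)
have no (i j k l : 'I_m.+1) : i < j -> j < k -> k < l ->
    p i < p k -> p k < p j -> p k < p l -> False.
  have [i1 h1 <-] := cyclic_iter_sur i cp; have [i2 h2 <-] := cyclic_iter_sur j cp.
  have [i3 h3 <-] := cyclic_iter_sur k cp; have [i4 h4 <-] := cyclic_iter_sur l cp.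
  by have := @cf_4 _ _ cf i1 i2 i3 i4; rewrite !ce ?iterS ?ltnS; lia.
apply/andP; split; [apply/andP; split|]; apply/negP.
- case/contains_1324 => i [j [k [l [[h1 h2 h3] [e1 e2 e3]]]]].
  by apply: (no i j k l) => //; lia.
- case/contains_1423 => i [j [k [l [[h1 h2 h3] [e1 e2 e3]]]]].
  by apply: (no i j k l) => //; lia.
- case/(cyclic_contains_213 cp) => i [j [k [ij jk km h1 h2]]].
  by have := @cf_213 _ _ cf i j k; rewrite !ce; lia.
Qed.

End CycleForm.

(* The cycle form of p^-1 is 1 followed by the reversal of the rest of that of
   p, and the initial 1 cannot play the first letter of 213 or 312. *)
Lemma cycle_form_contains_213V m (p : 'S_m.+1) : is_cyclic_perm p ->
  contains (cycle_form p) [:: 2; 1; 3] <->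
  contains (cycle_form (p^-1)%g) [:: 3; 1; 2].
Proof.
move=> cp; rewrite cyclic_contains_213 // cyclic_contains_312 ?is_cyclic_permV //.
split=> -[[|i] [j [k [ij jk km h1 h2]]]] //.
  exists (m.+1 - k), (m.+1 - j), (m.+1 - i.+1).
  rewrite !iter_cyclicV ?subKn; try lia.
  by split=> //; lia.
exists (m.+1 - k), (m.+1 - j), (m.+1 - i.+1).
rewrite !iter_cyclicV // in h1 h2; try lia.
by split=> //; lia.
Qed.

Lemma cycle_form_inj m (p q : 'S_m.+1) : is_cyclic_perm p -> is_cyclic_perm q ->
  cycle_form p = cycle_form q -> p = q.
Proof.
move=> cp cq e.
have it i : i <= m.+1 -> iter i p ord0 = iter i q ord0.
  move=> hi; apply: val_inj; have := nth_cycle_form_full cp hi.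
  by rewrite e nth_cycle_form_full // => -[].
apply/permP => x; have [i hi <-] := cyclic_iter_sur x cp.
by rewrite -iterS it // iterS it // ltnW.
Qed.

(** The permutation sends each letter to its successor in [w]; the default 1 of [nth] sends the last
    letter back to 1. *)
Lemma good_word_perm m w : good_word m.+1 w ->
  exists2 p : 'S_m.+1, is_cyclic_perm p & cycle_form p = w.
Proof.
case=> sw cf; set c := nth 1 w in cf.
have idx (x : 'I_m.+1) : index x.+1 w < m.+1 /\ c (index x.+1 w) = x.+1.
  have [i hi e] := @cf_sur _ _ cf x.+1 (ltn_ord x).
  have xw : x.+1 \in w by rewrite -e /c mem_nth ?sw.
  by split; [rewrite -[X in _ < X]sw index_mem|exact: nth_index].
have rng i : i <= m.+1 -> 1 <= c i <= m.+1.
  by rewrite leq_eqVlt => /orP [/eqP ->|/(cf_rng cf)]; first by rewrite (cf_n cf).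
pose f (x : 'I_m.+1) : 'I_m.+1 := inord (c (index x.+1 w).+1).-1.
have vf x : (f x : nat) = (c (index x.+1 w).+1).-1.
  by rewrite inordK //; have := rng (index x.+1 w).+1; have := idx x; lia.
have finj : injective f.
  move=> x y /(congr1 val); rewrite /= !vf.
  have [hx ex] := idx x; have [hy ey] := idx y.
  have rx := rng (index x.+1 w).+1 hx; have ry := rng (index y.+1 w).+1 hy.
  move=> e; have {}e : c (index x.+1 w).+1 = c (index y.+1 w).+1 by lia.
  suff ei : index x.+1 w = index y.+1 w.
    by apply: val_inj; move: ex; rewrite ei ey => -[].
  (* The successor of the last letter is 1, and all other successors exceed 1, so the wrap-around
     causes no collision. *)
  case: (ltngtP (index x.+1 w).+1 m.+1) => hx'; [|lia|];
    case: (ltngtP (index y.+1 w).+1 m.+1) => hy'; try lia.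
  - by case: (cf_inj cf hx' hy' e).
  - by have := cf_gt1 cf (ltn0Sn _) hx'; rewrite e hy' (cf_n cf).
  - by have := cf_gt1 cf (ltn0Sn _) hy'; rewrite -e hx' (cf_n cf).
pose p := perm finj.
have it i : i <= m -> (iter i p ord0 : nat) = (c i).-1.
  elim: i => [|i IH] hi; first by rewrite (cf_0 cf).
  rewrite iterS permE vf IH; last by lia.
  have ri := rng i ltac:(lia).
  rewrite prednK; last by lia.
  have [h1 h2] := idx (iter i p ord0); rewrite IH in h1 h2; last by lia.
  rewrite prednK in h1 h2; try lia.
  by rewrite (@cf_inj _ _ cf _ i h1 ltac:(lia) h2).
exists p.
  apply: cyclic_permP => x; have [i hi e] := @cf_sur _ _ cf x.+1 (ltn_ord x).
  by exists i; apply: val_inj; rewrite /= it // e.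
apply: (@eq_from_nth _ 1); rewrite size_cycle_form // => i hi.
by rewrite nth_cycle_form // it //; have := rng i; rewrite /c; lia.
Qed.

(** * The first count and its transfer by inversion *)

Lemma card_A_1324_1423_213 n : 0 < n ->
  a_num n [:: [:: 1; 3; 2; 4]; [:: 1; 4; 2; 3]] [:: 2; 1; 3] = 'C(n, 3) + 1.
Proof.
case: n => // m _; rewrite -size_good_words // /a_num cardE.
(* The cycle forms and the listed words are two repetition-free lists with the same members, so
   their lengths agree. *)
rewrite -(size_map (@cycle_form m.+1)); apply/perm_size/uniq_perm.
- rewrite map_inj_in_uniq ?enum_uniq // => p q.
  rewrite !mem_enum !inE => /andP [cp _] /andP [cq _].
  exact: cycle_form_inj.
- exact: uniq_good_words.
move=> w; apply/mapP/idP => [[p]|/good_wordsP gw].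
  rewrite mem_enum => pA ->; apply/good_wordsP => //.
  have cp : is_cyclic_perm p by move: pA; rewrite inE => /andP [].
  exact/mem_A_set_good.
have {gw} gw := gw isT; have [p cp e] := good_word_perm gw.
by exists p => //; rewrite mem_enum; apply/mem_A_set_good => //; rewrite e.
Qed.

Lemma mem_A_setV n (p : 'S_n) : 0 < n ->
  (p^-1%g \in A_set n [:: [:: 1; 3; 2; 4]; [:: 1; 3; 4; 2]] [:: 3; 1; 2]) =
  (p \in A_set n [:: [:: 1; 3; 2; 4]; [:: 1; 4; 2; 3]] [:: 2; 1; 3]).
Proof.
case: n p => // m p _; rewrite !inE is_cyclic_permV /= !andbT.
case cp : (is_cyclic_perm p) => //=; congr (~~ _ && ~~ _ && ~~ _).
- by apply/idP/idP => /contains_1324V //; rewrite invgK.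
- by apply/idP/idP => /contains_1423V.
- by apply/idP/idP => /(cycle_form_contains_213V cp).
Qed.

Theorem theorem4p8 (n : nat) (hn : 3 <= n) :
  a_num n [:: [:: 1; 3; 2; 4]; [:: 1; 4; 2; 3]] [:: 2; 1; 3] = 'C(n, 3) + 1 /\
  a_num n [:: [:: 1; 3; 2; 4]; [:: 1; 3; 4; 2]] [:: 3; 1; 2] = 'C(n, 3) + 1.
Proof.
have n0 : 0 < n by apply: ltn_trans hn.
split; first exact: card_A_1324_1423_213.
rewrite -card_A_1324_1423_213 // /a_num -(card_imset _ (@invg_inj _)).
apply: eq_card => p; apply/imsetP/idP => [[q qA ->]|pA].
  by rewrite -mem_A_setV // invgK.
by exists (p^-1)%g; rewrite ?invgK // mem_A_setV.
Qed.
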